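(* The semantic output membership problem is undecidable. This is the problem: given a variable $x$ and a LIF expression $\alpha$, decide whether $x\in O^{\mathrm{sem}}(\alpha)$.
   Context: **Basic setting.** A vocabulary $\mathcal S$ is a nonempty set of module names, each module name $M$ having an arity $ar(M)$ and an input arity $iar(M)\le ar(M)$ (natural numbers). Fix a countably infinite set $\mathbf{dom}$. An interpretation $D$ of $\mathcal S$ assigns to each module name $M$ an $ar(M)$-ary relation $D(M)$ over $\mathbf{dom}$. Fix a set $\mathbb V$ of variables, which may be finite or infinite. A valuation is a function $\mathbb V\to\mathbf{dom}$; $\mathcal V$ is the set of all valuations. Valuations agree outside $Y\subseteq\mathbb V$ if they have equal values on $\mathbb V- Y$. A BRV is a subset of $\mathcal V\times\mathcal V$. **Operations on BRVs** $A,B$ ($Z$ a finite set of variables; $x,y$ variables): union, intersection, set difference $A-B$; composition $A;B=\{(\nu_1,\nu_2)\mid\exists\nu_3:(\nu_1,\nu_3)\in A,(\nu_3,\nu_2)\in B\}$; converse $A^{-1}=\{(\nu_1,\nu_2)\mid(\nu_2,\nu_1)\in A\}$; left cylindrification $\mathrm{cyl}^l_Z(A)=\{(\nu_1,\nu_2)\mid\exists\nu_1':(\nu_1',\nu_2)\in A,\ \nu_1'\text{ and }\nu_1\text{ agree outside }Z\}$; right cylindrification $\mathrm{cyl}^r_Z(A)=\{(\nu_1,\nu_2)\mid\exists\nu_2':(\nu_1,\nu_2')\in A,\ \nu_2'\text{ and }\nu_2\text{ agree outside }Z\}$; selections $\sigma^l_{x=y}(A)=\{(\nu_1,\nu_2)\in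 A\mid\nu_1(x)=\nu_1(y)\}$, $\sigma^r_{x=y}(A)=\{(\nu_1,\nu_2)\in A\mid\nu_2(x)=\nu_2(y)\}$, $\sigma^{lr}_{x=y}(A)=\{(\nu_1,\nu_2)\in A\mid\nu_1(x)=\nu_2(y)\}$. **LIF expressions** over a vocabulary $\mathcal S$ are generated by $\alpha::=\mathit{id}\mid M(\bar x;\bar y)\mid\alpha\cup\alpha\mid\alpha\cap\alpha\mid\alpha-\alpha\mid\alpha;\alpha\mid\alpha^{-1}\mid\mathrm{cyl}^l_Z(\alpha)\mid\mathrm{cyl}^r_Z(\alpha)\mid\sigma^{lr}_{x=y}(\alpha)\mid\sigma^l_{x=y}(\alpha)\mid\sigma^r_{x=y}(\alpha)$, where $M$ is a module name of $\mathcal S$ and in an atomic module expression $M(\bar x;\bar y)$ the tuples of variables $\bar x,\bar y$ have lengths $iar(M)$ and $ar(M)-iar(M)$. Semantics: $[\![\mathit{id}]\!]_D=\{(\nu,\nu)\mid\nu\in\mathcal V\}$; $[\![M(\bar x;\bar y)]\!]_D=\{(\nu_1,\nu_2)\mid\nu_1(\bar x)\cdot\nu_2(\bar y)\in D(M)\text{ and }\nu_1,\nu_2\text{ agree outside }\bar y\}$ ($\cdot$ is concatenation of tuples); the other operators are interpreted by the corresponding BRV operations. **Semantic outputs.** $O^{\mathrm{sem}}(\alpha)$ is the set of variables $x$ for which there are an interpretation $D$ and $(\nu_1,\nu_2)\in[\![\alpha]\!]_D$ with $\nu_1(x)\ne\nu_2(x)$. *)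

(* Defs.v *)
From mathcomp Require Import finmap all_boot.
From mathcomp Require Import boolp classical_sets.

Set Implicit Arguments.
Unset Strict Implicit.
Unset Printing Implicit Defensive.

Local Open Scope classical_set_scope.

Record vocabulary := Vocabulary {
  mname :> countType;
  ar : mname -> nat;
  iar : mname -> nat;
  iar_le_ar : forall M, iar M <= ar M;
  mname_inhabited : inhabited mname }.

Definition interpretation (S : vocabulary) (dom : Type) :=
  forall M : S, set ((ar M).-tuple dom).

Section BRV.
Variables (V : countType) (dom : Type).

Definition valuation := V -> dom.
Definition brv := set (valuation * valuation).

Definition agree_outside (Y : {pred V}) (nu1 nu2 : valuation) :=
  forall v, v \notin Y -> nu1 v = nu2 v.

(** Left to right, unlike the library's [\;] on sets of pairs. *)
Definition brv_comp (A B : brv) : brv :=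
  [set p | exists2 nu, A (p.1, nu) & B (nu, p.2)].

Definition cyl_l (Z : {fset V}) (A : brv) : brv :=
  [set p | exists2 nu, A (nu, p.2) & agree_outside (mem Z) nu p.1].

Definition cyl_r (Z : {fset V}) (A : brv) : brv :=
  [set p | exists2 nu, A (p.1, nu) & agree_outside (mem Z) nu p.2].

Definition sel_l (x y : V) (A : brv) : brv := [set p | A p /\ p.1 x = p.1 y].
Definition sel_r (x y : V) (A : brv) : brv := [set p | A p /\ p.2 x = p.2 y].
Definition sel_lr (x y : V) (A : brv) : brv := [set p | A p /\ p.1 x = p.2 y].

End BRV.

Inductive lif (S : vocabulary) (V : countType) : Type :=
| Id
| Mod (M : S) (xs : (iar M).-tuple V) (ys : (ar M - iar M).-tuple V)
| Cup (a b : lif S V)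
| Cap (a b : lif S V)
| Diff (a b : lif S V)
| Comp (a b : lif S V)
| Conv (a : lif S V)
| CylL (Z : {fset V}) (a : lif S V)
| CylR (Z : {fset V}) (a : lif S V)
| SelLR (x y : V) (a : lif S V)
| SelL (x y : V) (a : lif S V)
| SelR (x y : V) (a : lif S V).

Arguments Id {S V}.

Definition mod_sem (S : vocabulary) (V : countType) (dom : Type)
    (D : interpretation S dom) (M : S) (xs : (iar M).-tuple V)
    (ys : (ar M - iar M).-tuple V) : brv V dom :=
  [set p | D M (tcast (subnKC (iar_le_ar M))
                  (cat_tuple (map_tuple p.1 xs) (map_tuple p.2 ys)))
           /\ agree_outside (mem ys) p.1 p.2].

Fixpoint sem (S : vocabulary) (V : countType) (dom : Type)
    (D : interpretation S dom) (a : lif S V) : brv V dom :=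
  match a with
  | Id => diagonal
  | Mod M xs ys => mod_sem D xs ys
  | Cup a b => sem D a `|` sem D b
  | Cap a b => sem D a `&` sem D b
  | Diff a b => sem D a `\` sem D b
  | Comp a b => brv_comp (sem D a) (sem D b)
  | Conv a => (sem D a)^-1%relation
  | CylL Z a => cyl_l Z (sem D a)
  | CylR Z a => cyl_r Z (sem D a)
  | SelLR x y a => sel_lr x y (sem D a)
  | SelL x y a => sel_l x y (sem D a)
  | SelR x y a => sel_r x y (sem D a)
  end.

Definition sem_outputs (S : vocabulary) (V : countType) (dom : Type)
    (a : lif S V) : set V :=
  [set x | exists (D : interpretation S dom) (nu1 nu2 : valuation V dom),
             sem D a (nu1, nu2) /\ nu1 x <> nu2 x].

(** Kleene's partial recursive functions.  [rec_graph f v y] means that [f] is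
    defined on the arguments [v] with value [y]. *)

Inductive recfun : nat -> Type :=
| RZero : recfun 0
| RSucc : recfun 1
| RProj n (i : 'I_n) : recfun n
| RComp k n (f : recfun k) (g : 'I_k -> recfun n) : recfun n
| RPrec n (f : recfun n) (g : recfun n.+2) : recfun n.+1
| RMu n (f : recfun n.+1) : recfun n.

Fixpoint rec_graph n (f : recfun n) : n.-tuple nat -> nat -> Prop :=
  match f in recfun n return n.-tuple nat -> nat -> Prop with
  | RZero => fun _ y => y = 0
  | RSucc => fun v y => y = (thead v).+1
  | RProj _ i => fun v y => y = tnth v i
  | RComp k _ f g => fun v y =>
      exists2 w : k.-tuple nat,
        forall i, rec_graph (g i) v (tnth w i) & rec_graph f w y
  | RPrec _ f g => fun v y =>
      (* [h] is the history of the recursion on the first argument *)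
      exists h : nat -> nat,
        [/\ rec_graph f (behead_tuple v) (h 0),
            forall j, j < thead v ->
              rec_graph g (cons_tuple j (cons_tuple (h j) (behead_tuple v)))
                (h j.+1)
          & y = h (thead v)]
  | RMu _ f => fun v y =>
      rec_graph f (cons_tuple y v) 0 /\
      forall j, j < y -> exists k, rec_graph f (cons_tuple j v) k.+1
  end.

(** The problem with set of instances [I], given to an algorithm through their
    codes, and positive instances [P].  Nothing is required of the
    algorithm on numbers that are not codes. *)
Definition algorithmically_decidable (I : Type) (code : I -> nat)
    (P : I -> Prop) :=
  exists f : recfun 1, forall i : I,
    (P i -> rec_graph f [tuple code i] 1) /\
    (~ P i -> rec_graph f [tuple code i] 0).

(** [CodeSeq.code] is the bijective coding of [seq nat] as [nat].  A module
    atom carries the number of its module name; the arity and input arity of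
    that name can be read off the lengths of the argument tuples. *)
Fixpoint lif_code (S : vocabulary) (V : countType) (a : lif S V) : nat :=
  match a with
  | Id => CodeSeq.code [:: 0]
  | Mod M xs ys =>
      CodeSeq.code [:: 1; pickle M; CodeSeq.code (map pickle xs);
                                    CodeSeq.code (map pickle ys)]
  | Cup a b => CodeSeq.code [:: 2; lif_code a; lif_code b]
  | Cap a b => CodeSeq.code [:: 3; lif_code a; lif_code b]
  | Diff a b => CodeSeq.code [:: 4; lif_code a; lif_code b]
  | Comp a b => CodeSeq.code [:: 5; lif_code a; lif_code b]
  | Conv a => CodeSeq.code [:: 6; lif_code a]
  | CylL Z a => CodeSeq.code [:: 7; CodeSeq.code (map pickle Z); lif_code a]
  | CylR Z a => CodeSeq.code [:: 8; CodeSeq.code (map pickle Z); lif_code a]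
  | SelLR x y a => CodeSeq.code [:: 9; pickle x; pickle y; lif_code a]
  | SelL x y a => CodeSeq.code [:: 10; pickle x; pickle y; lif_code a]
  | SelR x y a => CodeSeq.code [:: 11; pickle x; pickle y; lif_code a]
  end.

(** The vocabulary is part of the instance: over some fixed vocabularies, such
    as one with a single nullary module name, the problem is decidable. *)
Record osem_instance (V : countType) := OsemInstance {
  oi_voc : vocabulary;
  oi_var : V;
  oi_expr : lif oi_voc V }.

Definition osem_code (V : countType) (i : osem_instance V) : nat :=
  CodeSeq.code [:: pickle (oi_var i); lif_code (oi_expr i)].

Definition osem_membership (V : countType) (dom : Type)
    (i : osem_instance V) : Prop :=
  sem_outputs dom (oi_expr i) (oi_var i).

(** The code determines the answer, although it keeps only the numbers of the
    module names and not the vocabulary itself. *)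

Section CodeSound.
Variables (V : countType) (dom : Type) (S S' : vocabulary).

Let codeI : injective CodeSeq.code := can_inj CodeSeq.codeK.
Let pickleI (T : countType) : injective (@pickle T) := pcan_inj pickleK.

Let transport (D : interpretation S dom) : interpretation S' dom :=
  fun M' => [set t | exists (M : S) (s : (ar M).-tuple dom),
    [/\ pickle M = pickle M', tval s = tval t & D M s]].

Lemma sem_transport (D : interpretation S dom) (a : lif S V) (a' : lif S' V) :
  lif_code a = lif_code a' -> sem (transport D) a' = sem D a.
Proof.
elim: a a' => [|M xs ys|a IHa b IHb|a IHa b IHb|a IHa b IHb|a IHa b IHb|a IHa
  |Z a IHa|Z a IHa|x y a IHa|x y a IHa|x y a IHa]
  [|M' xs' ys'|a' b'|a' b'|a' b'|a' b'|a'|Z' a'|Z' a'|x' y' a'|x' y' a'|x' y' a']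
  /codeI // [].
- move=> eM /codeI exs /codeI eys.
  have {}exs := inj_map (@pickleI V) exs.
  have {}eys := inj_map (@pickleI V) eys.
  have eY v : (v \notin mem ys') = (v \notin mem ys).
    by rewrite -[LHS]/(v \notin tval ys') -eys.
  apply/seteqP; split=> -[nu1 nu2] /= [HD Ha]; split.
  + case: HD => M0 [s []]; rewrite -eM => /pickleI e.
    move: s; rewrite e => s es; congr (D _ _); apply: val_inj => /=.
    by rewrite es !val_tcast /= exs eys.
  + by move=> v vy; apply: Ha; rewrite ?eY // -eY.
  + exists M; eexists; split; [by [] | | exact: HD].
    by rewrite !val_tcast /= exs eys.
  + by move=> v vy; apply: Ha; rewrite ?eY // -eY.
- by move=> /IHa /= -> /IHb ->.
- by move=> /IHa /= -> /IHb ->.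
- by move=> /IHa /= -> /IHb ->.
- by move=> /IHa /= -> /IHb ->.
- by move=> /IHa /= ->.
- by move=> /codeI/(inj_map (@pickleI V))/val_inj -> /IHa /= ->.
- by move=> /codeI/(inj_map (@pickleI V))/val_inj -> /IHa /= ->.
- by move=> /pickleI -> /pickleI -> /IHa /= ->.
- by move=> /pickleI -> /pickleI -> /IHa /= ->.
- by move=> /pickleI -> /pickleI -> /IHa /= ->.
Qed.

Lemma sem_outputs_code (a : lif S V) (a' : lif S' V) :
  lif_code a = lif_code a' -> sem_outputs dom a `<=` sem_outputs dom a'.
Proof.
move=> e x [D [nu1 [nu2 [H nx]]]].
by exists (transport D), nu1, nu2; rewrite (sem_transport D e).
Qed.

End CodeSound.

Lemma osem_code_sound (V : countType) (dom : Type) (i j : osem_instance V) :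
  osem_code i = osem_code j -> osem_membership dom i -> osem_membership dom j.
Proof.
case: i j => [S x a] [S' x' a'] /(can_inj CodeSeq.codeK)[].
by move=> /(pcan_inj pickleK) -> /sem_outputs_code; apply.
Qed.

(* Main.v *)
(** A LIF expression that only changes the variable [x] defines a binary
    relation on the domain, and LIF contains the whole calculus of binary
    relations with complement.  In that calculus every partial recursive
    function [f] is computed by a positive term with reflexive transitive
    closures over zero, successor, head and tail of lists; a closure is replaced
    by a module name constrained by two inclusions, and finitely many inclusions
    can be asserted by one LIF expression.  In every model of the constraints
    the term contains the computations of [f], and in the standard model it is
    the graph of [f].  So "[f n = 1] is not derivable" can be expressed by [A_f]
    intersected with the numeral [n], where [A_f] does not depend on [n]; for
    [f n] equal to 0 or 1 this is satisfiable, and then has [x] as an output,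
    exactly when [f n = 0].  If [f] decided membership, let [g] map [t] to the
    answer of [f] on the code of "the expression coded by [t], intersected with
    the numeral [t]".  At the code of [A_g] the function [g] gives the answer of
    [f] on an instance that is positive exactly when this answer is 0. *)

From HB Require Import structures.
Require Import Defs.
From mathcomp Require Import finmap all_boot.
From mathcomp Require Import boolp classical_sets.

Set Implicit Arguments.
Unset Strict Implicit.
Unset Printing Implicit Defensive.

(** * Partial recursive functions *)

Lemma rec_graph_functional n (f : recfun n) v y y' :
  rec_graph f v y -> rec_graph f v y' -> y = y'.
Proof.
elim: f v y y' => {n} /=.
- by move=> v y y' -> ->.
- by move=> v y y' -> ->.
- by move=> n i v y y' -> ->.
- move=> k n f IHf g IHg v y y' [w gw fw] [w' gw' fw'].
  suff ew : w = w' by apply: IHf fw _; rewrite ew.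
  by apply: eq_from_tnth => i; apply: IHg (gw i) (gw' i).
- move=> n f IHf g IHg v y y' [h [f0 gS ->]] [h' [f0' gS' ->]].
  suff eh j : j <= thead v -> h j = h' j by apply: eh.
  elim: j => [_|j IHj lt_jv]; first exact: IHf f0 f0'.
  apply: IHg (gS _ lt_jv) _; rewrite IHj ?(ltnW lt_jv) //.
  exact: gS'.
- move=> n f IHf v y y' [fy lty] [fy' lty'].
  (* If the two minima differed, [f] would be both 0 and a successor at the smaller one. *)
  case: (ltngtP y y') => // lt.
    by have [k /(IHf _ _ _ fy)] := lty' _ lt.
  by have [k /(IHf _ _ _ fy')] := lty _ lt.
Qed.

Lemma rec_graph_val n (f : recfun n) v w y :
  tval v = tval w -> rec_graph f v y -> rec_graph f w y.
Proof. by move/val_inj->. Qed.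

Definition recursive n (F : n.-tuple nat -> nat) :=
  exists f : recfun n, forall v, rec_graph f v (F v).

Definition recursive1 (h : nat -> nat) :=
  recursive (fun v : 1.-tuple nat => h (tnth v ord0)).

Definition recursive2 (h : nat -> nat -> nat) :=
  recursive (fun v : 2.-tuple nat => h (tnth v ord0) (tnth v ord_max)).

Lemma eq_recursive n (F G : n.-tuple nat -> nat) :
  F =1 G -> recursive F -> recursive G.
Proof. by move=> eFG [f fP]; exists f => v; rewrite -eFG. Qed.

Lemma recursive_proj n (i : 'I_n) : recursive (fun v => tnth v i).
Proof. by exists (RProj i). Qed.

Lemma recursive_comp1 n h (F : n.-tuple nat -> nat) :
  recursive1 h -> recursive F -> recursive (fun v => h (F v)).
Proof.
move=> [f fP] [g gP]; exists (RComp f (fun=> g)) => v /=.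
exists [tuple F v] => [i|]; last exact: fP.
by rewrite (tnth_nth 0) ord1; apply: gP.
Qed.

Lemma recursive_comp2 n h (F G : n.-tuple nat -> nat) :
  recursive2 h -> recursive F -> recursive G ->
  recursive (fun v => h (F v) (G v)).
Proof.
move=> [f fP] [g gP] [g' gP'].
exists (RComp f (fun i => if val i is 0 then g else g')) => v /=.
exists [tuple F v; G v]; last exact: fP.
by case=> [[|[|i]] lti] //=; rewrite (tnth_nth 0).
Qed.

Lemma recursive_succ : recursive1 succn.
Proof. by exists RSucc => v /=; rewrite /thead. Qed.

Lemma recursive_const n c : recursive (fun _ : n.-tuple nat => c).
Proof.
elim: c => [|c]; last exact: recursive_comp1 recursive_succ.
have g : 'I_0 -> recfun n by case.
by exists (RComp RZero g) => v; exists [tuple] => [[]|].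
Qed.

Lemma recursive_iter (h : nat -> nat -> nat) b :
  recursive2 h -> recursive1 b ->
  recursive2 (fun m a => iter m (h a) (b a)).
Proof.
move=> rh [f fP].
(* The step of [RPrec] receives the counter, the previous value and the parameter; the counter is
   dropped. *)
have [g gP] : recursive (fun v : 3.-tuple nat =>
    h (tnth v ord_max) (tnth v (inord 1))).
  by apply: recursive_comp2 => //; apply: recursive_proj.
exists (RPrec f g) => v /=.
case/tupleP: v => m v; case/tupleP: v => a v; rewrite tuple0 /= {v}.
exists (fun j => iter j (h a) (b a)); split => [|j _|].
- have := fP [tuple a]; rewrite (tnth_nth 0) /=.
  exact: rec_graph_val.
- have := gP [tuple j; iter j (h a) (b a); a].
  rewrite !(tnth_nth 0) /= inordK //.
  exact: rec_graph_val.
- by rewrite !(tnth_nth 0).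
Qed.

(** [CodeSeq.code] sends [n :: s] to [2 ^ n * (2 * c + 1)], with [c] the code of [s]; sums, products
    and powers of two all come from iteration. *)
Lemma recursive_code n (s : seq (n.-tuple nat -> nat)) :
  foldr (fun F => and (recursive F)) True s ->
  recursive (fun v => CodeSeq.code [seq F v | F <- s]).
Proof.
have r1 : recursive1 id by apply: recursive_proj.
have r2r : recursive2 (fun _ x => x) by apply: recursive_proj.
have radd : recursive2 (fun m a => m + a).
  have rS : recursive2 (fun _ => succn).
    exact: recursive_comp1 recursive_succ r2r.
  apply: eq_recursive (recursive_iter rS r1) => v.
  by elim: (tnth v ord0) => //= m ->.
have rmul : recursive2 (fun m a => m * a).
  apply: eq_recursive (recursive_iter radd (recursive_const _ 0)).
  by move=> v; elim: (tnth v ord0) => //= m ->.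
have rexp : recursive1 (fun m => 2 ^ m).
  have rdbl : recursive2 (fun _ m => m + m).
    exact: (recursive_comp2 radd r2r r2r).
  have r2 := recursive_iter (b := fun=> 1) rdbl (recursive_const _ 1).
  apply: eq_recursive (recursive_comp2 r2 r1 r1) => v.
  elim: (tnth v ord0) => //= m ->.
  by rewrite addnn expnS mul2n.
elim: s => [_|F s IHs [rF /IHs rs]] /=; first exact: recursive_const.
apply: recursive_comp2 rmul (recursive_comp1 rexp rF) _.
apply: recursive_comp1 recursive_succ _.
apply: eq_recursive (recursive_comp2 radd rs rs) => v.
by rewrite addnn.
Qed.

(** * Relational terms for partial recursive functions *)

Inductive rexp :=
| Zero | Succ | Head | Tail | Full
| Inv (a : rexp)
| Meet (a b : rexp)
| Seq (a b : rexp)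
| Star (a : rexp).

(** The terms will serve as module names, so they have to form a countable type. *)
Fixpoint rexp_tree (a : rexp) : GenTree.tree nat :=
  match a with
  | Zero => GenTree.Leaf 0
  | Succ => GenTree.Leaf 1
  | Head => GenTree.Leaf 2
  | Tail => GenTree.Leaf 3
  | Full => GenTree.Leaf 4
  | Inv a => GenTree.Node 0 [:: rexp_tree a]
  | Meet a b => GenTree.Node 1 [:: rexp_tree a; rexp_tree b]
  | Seq a b => GenTree.Node 2 [:: rexp_tree a; rexp_tree b]
  | Star a => GenTree.Node 3 [:: rexp_tree a]
  end.

Fixpoint tree_rexp (t : GenTree.tree nat) : rexp :=
  match t with
  | GenTree.Leaf 0 => Zero
  | GenTree.Leaf 1 => Succ
  | GenTree.Leaf 2 => Head
  | GenTree.Leaf 3 => Tail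
  | GenTree.Node 0 [:: t] => Inv (tree_rexp t)
  | GenTree.Node 1 [:: t; u] => Meet (tree_rexp t) (tree_rexp u)
  | GenTree.Node 2 [:: t; u] => Seq (tree_rexp t) (tree_rexp u)
  | GenTree.Node 3 [:: t] => Star (tree_rexp t)
  | _ => Full
  end.

Lemma rexp_treeK : cancel rexp_tree tree_rexp.
Proof. by elim=> //= [a ->|a -> b ->|a -> b ->|a ->]. Qed.

HB.instance Definition _ := Countable.copy rexp (can_type rexp_treeK).

(* The basic relations and the stars are uninterpreted: [I] is indexed by the
   terms, of which only those five kinds matter. *)
Fixpoint eval (T : Type) (I : rexp -> T -> T -> Prop) (a : rexp) :
    T -> T -> Prop :=
  match a with
  | Zero => fun _ y => exists x, I Zero x y
  | Full => fun _ _ => True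
  | Inv a => fun x y => eval I a y x
  | Meet a b => fun x y => eval I a x y /\ eval I b x y
  | Seq a b => fun x y => exists2 z, eval I a x z & eval I b z y
  | a => I a
  end.

Definition pair_with (F G : rexp) := Meet (Seq F (Inv Head)) (Seq G (Inv Tail)).

(* A tuple is a list.  The loop of [RPrec f g] on [n :: v] has states
   [j :: y :: v], with [y] the value of the recursion at [j]; the loop of
   [RMu f] on [v] has states [j :: v]. *)
Definition prec_init F := pair_with Zero (pair_with (Seq Tail F) Tail).
Definition prec_step G :=
  pair_with (Seq Head Succ) (pair_with G (Seq Tail Tail)).
Definition mu_init := Meet (Seq Zero (Inv Head)) (Inv Tail).
(** The factor [Seq (Inv Succ) Full] tests that the value is a successor and then forgets it. *)
Definition mu_step F :=
  Meet (Seq F (Seq (Inv Succ) Full)) (pair_with (Seq Head Succ) Tail).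

(** [RComp] lists the inner values and ends with [Zero], the code of the empty list. In [RPrec],
    [Seq Head (Inv Head)] lets the loop stop where its counter is the first argument. *)
Fixpoint compile n (f : recfun n) : rexp :=
  match f with
  | RZero => Zero
  | RSucc => Seq Head Succ
  | RProj _ i => iter i (Seq Tail) Head
  | RComp k _ f g =>
      Seq (foldr (fun i => pair_with (compile (g i))) Zero (enum 'I_k))
          (compile f)
  | RPrec _ f g =>
      Seq (Meet (Seq (prec_init (compile f)) (Star (prec_step (compile g))))
                (Seq Head (Inv Head)))
          (Seq Tail Head)
  | RMu _ f =>
      Seq (Seq mu_init (Star (mu_step (compile f))))
          (Meet (Seq (compile f) (Inv Zero)) Head)
  end.

(** * Every model contains the computations *)

Section Sound.
Variables (T : Type) (I : rexp -> T -> T -> Prop).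

(** Bounds each star from below only: it contains the reflexive transitive closure and may be
    larger. *)
Fixpoint star_closed (a : rexp) : Prop :=
  match a with
  | Inv a => star_closed a
  | Meet a b | Seq a b => star_closed a /\ star_closed b
  | Star a =>
      [/\ star_closed a, forall x, I (Star a) x x
        & forall x y z, I (Star a) x y -> eval I a y z -> I (Star a) x z]
  | _ => True
  end.

(** Existence axioms only: an element may stand for several numbers, and a number may have several
    elements. *)
Record arith_model := ArithModel {
  model_zero : exists x y, I Zero y x;
  model_succ : forall x, exists y, I Succ x y;
  model_pair : forall x y, exists2 t, I Head t x & I Tail t y }.

Fixpoint numeral (n : nat) (x : T) : Prop :=
  if n is m.+1 then exists2 y, numeral m y & I Succ y x
  else exists y, I Zero y x.

Fixpoint represents (s : seq nat) (t : T) : Prop :=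
  if s is n :: s' then
    exists x t', [/\ I Head t x, numeral n x, I Tail t t' & represents s' t']
  else numeral 0 t.

Hypothesis IP : arith_model.

Lemma numeral_ex n : exists x, numeral n x.
Proof.
elim: n => [|n [x nx]] /=; first exact: model_zero IP.
by have [y xy] := model_succ IP x; exists y, x.
Qed.

Lemma eval_pair_with F G t x y :
  eval I F t x -> eval I G t y ->
  exists s, [/\ eval I (pair_with F G) t s, I Head s x & I Tail s y].
Proof.
move=> Fx Gy; have [s sx sy] := model_pair IP x y.
by exists s; split=> //; split; [exists x|exists y].
Qed.

Lemma compile_sound n (f : recfun n) (v : n.-tuple nat) y t :
  star_closed (compile f) -> rec_graph f v y -> represents v t ->
  exists2 u, numeral y u & eval I (compile f) t u.
Proof.
elim: f v y t => {n}.
- by move=> v y t _ /= -> _; have [x x0] := numeral_ex 0; exists x.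
- move=> v y t _ /= ->; case/tupleP: v => m v /= [x [t' [tx mx _ _]]].
  have [u xu] := model_succ IP x.
  by exists u; exists x.
- move=> n i v y t _ /= ->; rewrite (tnth_nth 0).
  have : i < size v by rewrite size_tuple.
  elim: (val i) (tval v) t => [|j IHj] [//|m s] t.
    by move=> _ /= [x [t' [tx mx _ _]]]; exists x.
  move=> /= lt_js [x [t' [_ _ tt' st']]].
  by have [u] := IHj s t' lt_js st'; exists u => //; exists t'.
- move=> k n f IHf g IHg v y t /= [cg cf] [w gw fw] vt.
  suff [t' wt' gt'] : exists2 t', represents w t' &
      eval I (foldr (fun i => pair_with (compile (g i))) Zero (enum 'I_k)) t t'.
    by have [u yu ft'] := IHf _ _ _ cf fw wt'; exists u => //; exists t'.
  have -> : tval w = [seq tnth w i | i <- enum 'I_k].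
    by rewrite -[in LHS](map_tnth_enum w).
  elim: (enum 'I_k) cg => [|i l IHl] /= => [_|[[ci _] [cl _]]].
    by have [x x0] := numeral_ex 0; exists x.
  have [u iu gu] := IHg i _ _ _ ci (gw i) vt.
  have [t' lt' gt'] := IHl cl.
  have [s [gs su st']] := eval_pair_with gu gt'.
  by exists s => //; exists u, t'.
- move=> n f IHf g IHg v y t [[[ci [cs starR starS]] _] _] [h [fh gh ->]].
  case/tupleP: v fh gh => m v.
  have -> : behead_tuple [tuple of m :: v] = v by apply: val_inj.
  rewrite /= => fh gh.
  move=> [x [t' [tx mx tt' vt']]].
  (* The exit test compares elements, and [x] need not be the only numeral [m]. So the final state
     must have head [x] itself, and the loop climbs the successor chain that witnesses
     [numeral m x]. *)
  suff [s [r [u [sx sr ru hu rs]]]] : exists s r u, [/\ I Head s x, I Tail s r,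
      I Head r u, numeral (h m) u /\ I Tail r t'
      & exists2 s0, eval I (prec_init (compile f)) t s0 &
        I (Star (prec_step (compile g))) s0 s].
    exists u; first by case: hu.
    exists s; last by exists r.
    by split=> //; exists x.
  have {ci} cf : star_closed (compile f) by case: ci => _ [[[[]]]].
  have {cs} cg : star_closed (compile g) by case: cs => _ [[[]]].
  elim: m x {tx} mx gh => [|m IHm] x mx gh.
    have [u hu ft'] := IHf _ _ _ cf fh vt'.
    have [r [tr ru rt']] := @eval_pair_with (Seq Tail (compile f)) Tail
      t u t' (ex_intro2 _ _ t' tt' ft') tt'.
    have [s [ts sx sr]] := @eval_pair_with Zero _ t x r mx tr.
    by exists s, r, u; split=> //; exists s.
  case: mx => x0 mx0 xx0.
  have [|s [r [u [sx sr ru [hu rt'] [s0 ts0 ss0]]]]] := IHm x0 mx0.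
    by move=> j lt_jm; apply: gh; rewrite ltnW.
  have [|u' hu' su'] := IHg _ _ s cg (gh m (ltnSn m)).
    by exists x0, r; split=> //; exists u, t'; split=> //.
  have [r' [sr' ru' rt'']] := @eval_pair_with _ (Seq Tail Tail) s u' t' su'
    (ex_intro2 _ _ r sr rt').
  have [s' [ss' sx' sr'']] := @eval_pair_with (Seq Head Succ) _ s x r'
    (ex_intro2 _ _ x0 sx xx0) sr'.
  exists s', r', u'; split=> //; exists s0 => //.
  exact: starS ss0 ss'.
- move=> n f IHf v y t [[ci [cs starR starS]] [[cf _] _]] [fy ltyf] vt.
  suff [s [x [sx yx st [s0 ts0 ss0]]]] : exists s x, [/\ I Head s x,
      numeral y x, I Tail s t & exists2 s0, eval I mu_init t s0 &
      I (Star (mu_step (compile f))) s0 s].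
    have [|u u0 su] := IHf _ _ s cf fy; first by exists x, t.
    exists x => //; exists s; first by exists s0.
    by split=> //; exists u.
  elim: y ltyf {fy} => [|y IHy] ltyf.
    have [x x0] := numeral_ex 0; have [s sx st] := model_pair IP x t.
    by exists s, x; split=> //; exists s => //; split=> //; exists x.
  have [|s [x [sx yx st [s0 ts0 ss0]]]] := IHy.
    by move=> j lt_jy; apply: ltyf; rewrite ltnW.
  have [k fk] := ltyf y (ltnSn y).
  have [|u [u' ku' uu'] su] := IHf _ _ s cf fk; first by exists x, t.
  have [x' xx'] := model_succ IP x.
  have [s' [ss' sx' st']] := @eval_pair_with (Seq Head Succ) Tail s x' t
    (ex_intro2 _ _ x sx xx') st.
  exists s', x'; split=> //; first by exists x.
  exists s0 => //; apply: starS ss0 _; split=> //.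
  by exists u => //; exists u'.
Qed.
End Sound.

(** * The standard model contains only the computations *)

Section Standard.
Variables (T : Type) (e : T -> nat).

Let entries (t : T) : seq nat := CodeSeq.decode (e t).

(** Serves both as the interpretation of the atoms and as the meaning of all terms. The star is now
    the least closure, given by its induction principle. *)
Fixpoint std (a : rexp) : T -> T -> Prop :=
  match a with
  | Zero => fun _ y => e y = 0
  | Succ => fun x y => e y = (e x).+1
  | Head => fun t x => exists s, entries t = e x :: s
  | Tail => fun t t' => exists m, entries t = m :: entries t'
  | Full => fun _ _ => True
  | Inv a => fun x y => std a y x
  | Meet a b => fun x y => std a x y /\ std b x y
  | Seq a b => fun x y => exists2 z, std a x z & std b z y
  | Star a => fun x y => forall P : T -> Prop,
      P x -> (forall z w, P z -> std a z w -> P w) -> P y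
  end.

Lemma eval_std (a : rexp) x y : eval std a x y <-> std a x y.
Proof.
elim: a x y => //= [x y|a IHa b IHb x y|a IHa b IHb x y].
- by split=> [[]|] //; exists x.
- by rewrite IHa IHb.
- by split=> -[z /IHa az /IHb bz]; exists z.
Qed.

Lemma std_star_closed (a : rexp) : star_closed std a.
Proof.
elim: a => //= a IHa; split=> // x y z xy /eval_std yz P Px Ps.
exact: Ps (xy P Px Ps) yz.
Qed.

Lemma std_model : (forall n, exists x, e x = n) -> arith_model std.
Proof.
move=> e_surj; split=> [|x|x y].
- by have [x x0] := e_surj 0; exists x, x.
- by have [y xy] := e_surj (e x).+1; exists y.
- have [t et] := e_surj (CodeSeq.code (e x :: entries y)).
  by exists t; [exists (entries y)|exists (e x)];
    rewrite /entries et CodeSeq.codeK.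
Qed.

Lemma std_numeral n x : (forall n, exists x, e x = n) -> e x = n ->
  numeral std n x.
Proof.
move=> e_surj; elim: n x => [|n IHn] x ex /=; first by exists x.
by have [y ey] := e_surj n; exists y; [exact: IHn | rewrite ex ey].
Qed.

Lemma std_pair_with F G t s : std (pair_with F G) t s ->
  exists x y, [/\ std F t x, std G t y & entries s = e x :: entries y].
Proof.
move=> /= [[x Fx [l sx]] [y Gy [m sy]]]; exists x, y; split=> //.
by move: sx; rewrite sy => -[-> _].
Qed.

(** Since stars are least here, an invariant that holds initially and survives a step holds in every
    reachable loop state. *)
Lemma std_compile n (f : recfun n) (v : n.-tuple nat) t u :
  entries t = v -> std (compile f) t u -> rec_graph f v (e u).
Proof.
elim: f v t u => {n}.
- by move=> v t u _ /= ->.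
- by move=> v t u; case/tupleP: v => m v /= -> [x [s [-> _]]].
- move=> n i v t u; rewrite /= (tnth_nth 0).
  elim: (val i) (tval v) t => [|j IHj] s t /=.
    by move=> -> [s' ->].
  by move=> -> [t' [m ->]] /(IHj _ _ erefl).
- move=> k n f IHf g IHg v t u tv /= [t' gt' ft'].
  (* A plain list allows induction along the indices; [i0] is quantified because ['I_k] may be
     empty. *)
  suff [w [t'w sz gw]] : exists w : seq nat, [/\ entries t' = w,
      size w = size (enum 'I_k) & forall j (ltj : j < size (enum 'I_k)) i0,
        rec_graph (g (nth i0 (enum 'I_k) j)) v (nth 0 w j)].
    have {}sz : size w == k by rewrite sz size_enum_ord.
    exists (Tuple sz) => [i|]; last exact: IHf ft'.
    rewrite (tnth_nth 0) /= -[in g _](nth_ord_enum i i).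
    by apply: gw; rewrite size_enum_ord.
  elim: (enum 'I_k) t' gt' {ft'} => [|i l IHl] t'.
    by move=> /= t'0; exists [::]; rewrite /entries t'0.
  move=> /std_pair_with [x [s [gx ls t'x]]].
  have [w [sw sz gw]] := IHl _ ls.
  exists (e x :: w); split; [by rewrite t'x sw | by rewrite /= sz |].
  by case=> [_ i0|j ltj i0]; [apply: IHg tv gx | apply: gw].
- move=> n f IHf g IHg v t u tv [s [[s0 ts0 ss0] [x [l tx] [l' sx]]]].
  move=> [r [j sr] [l'' ru]].
  case/tupleP: v tv => m v tmv; have {}tmv : entries t = m :: v := tmv.
  move: tx; rewrite tmv => -[em _].
  rewrite /= theadE.
  have -> : behead_tuple [tuple of m :: v] = v by apply: val_inj.
  rewrite {}em.
  (* Each state holds a counter [i] and the last value of a correct history up to [i]; the exit test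
     then forces [i = m]. *)
  pose inv s := exists (h : nat -> nat) i,
    [/\ entries s = [:: i, h i & v], rec_graph f v (h 0)
      & forall j, j < i ->
          rec_graph g (cons_tuple j (cons_tuple (h j) v)) (h j.+1)].
  suff [h [i [es h0 hS]]] : inv s.
    move: sx sr; rewrite es => -[<- _] [_ er]; move: ru; rewrite -er => -[<- _].
    by exists h.
  apply: (ss0 inv) => {s ss0 sx sr r ru j l l' l''} [|s s'].
    have {}ts0 : std (pair_with Zero
      (pair_with (Seq Tail (compile f)) Tail)) t s0 := ts0.
    have [y [r [y0 /std_pair_with [h0 [t' [fh tt' rt']]] s0y]]] :=
      std_pair_with ts0.
    have tv' : entries t' = v by case: tt' => m'; rewrite tmv => -[].
    case: fh => t1 [m1]; rewrite tmv => -[_ /esym t1v] /(IHf _ _ _ t1v) fh.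
    exists (fun=> e h0), 0; split=> //.
    by rewrite s0y rt' tv'; congr [:: _, _ & _].
  move=> [h [i [es h0 hS]]] ss'.
  have {ss'} /std_pair_with [y [r [[z [l sz] zy]]]] : std (pair_with
    (Seq Head Succ) (pair_with (compile g) (Seq Tail Tail))) s s' := ss'.
  move=> /std_pair_with [h1 [t' [gh1 [s1 [j1 ss1] [j2 s1t']] rt']]] s'y.
  (* The history is overwritten at [i.+1] alone, with the value just computed. *)
  exists (fun j => if j == i.+1 then e h1 else h j), i.+1; rewrite eqxx.
  have eyi : e y = i.+1 by rewrite zy; move: sz; rewrite es => -[->].
  have et' : entries t' = v.
    by move: ss1; rewrite es => -[_]; rewrite s1t' => -[].
  split=> //; first by rewrite s'y rt' et' eyi.
  move=> j; rewrite ltnS leq_eqVlt eqSS => /orP[/eqP->|lt_ji].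
    by rewrite eqxx ltn_eqF //; apply: IHg gh1.
  by rewrite !ltn_eqF ?ltnS ?(ltnW lt_ji) //; apply: hS.
- move=> n f IHf v t u tv [s [s0 [[z z0 [l s0z]] [m s0t]] ss0]].
  move=> [[w fw w0] [l' su]].
  pose inv s := exists i, entries s = i :: v /\ forall j, j < i ->
    exists k, rec_graph f (cons_tuple j v) k.+1.
  suff [i [es lti]] : inv s.
    move: su; rewrite es => -[<- _]; split=> //.
    by rewrite -w0; apply: IHf fw.
  apply: (ss0 inv) => {s ss0 su fw} [|s s'].
    by exists 0; split=> //; rewrite -tv; move: s0z; rewrite s0t z0 => -[-> _].
  move=> [i [es lti]] [[x fx [k xk _]]].
  move=> /(@std_pair_with (Seq Head Succ) Tail).
  move=> [y [r [[x' [l1 sx'] x'y] [m' sr] s'y]]].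
  have eyi : e y = i.+1 by rewrite x'y; move: sx'; rewrite es => -[->].
  exists i.+1; split=> [|j].
    by rewrite s'y eyi; move: sr; rewrite es => -[_ ->].
  rewrite ltnS leq_eqVlt => /orP[/eqP->|]; last exact: lti.
  by exists (e k); rewrite -xk; apply: IHf fx.
Qed.
End Standard.

(** * Relational terms as LIF expressions on a single variable *)

Definition rexp_voc : vocabulary :=
  @Vocabulary rexp (fun=> 2) (fun=> 1) (fun=> isT) (inhabits Zero).

Section Translation.
Variables (V : countType) (x : V).

Definition atom (a : rexp) : lif rexp_voc V :=
  @Mod rexp_voc V a [tuple x] [tuple x].

(** The top of the calculus, all pairs agreeing outside [x]; complements are relative to it. *)
Definition full : lif rexp_voc V := CylR [fset x]%fset Id.

(** Composing [Zero] with [full] makes it independent of the first component. *)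
Fixpoint lif_of (a : rexp) : lif rexp_voc V :=
  match a with
  | Zero => Comp full (atom Zero)
  | Full => full
  | Inv a => Conv (lif_of a)
  | Meet a b => Cap (lif_of a) (lif_of b)
  | Seq a b => Comp (lif_of a) (lif_of b)
  | a => atom a
  end.

(** On expressions that define relations on the domain this is a truth value, [full] or empty, so
    intersection acts as conjunction. *)
Definition incl (A B : lif rexp_voc V) :=
  Diff full (Comp full (Comp (Diff A B) full)).

Fixpoint star_axioms (a : rexp) : lif rexp_voc V :=
  match a with
  | Inv a => star_axioms a
  | Meet a b | Seq a b => Cap (star_axioms a) (star_axioms b)
  | Star a =>
      Cap (star_axioms a)
        (Cap (incl Id (atom (Star a)))
             (incl (Comp (atom (Star a)) (lif_of a)) (atom (Star a))))
  | _ => full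
  end.

Definition model_axioms : lif rexp_voc V :=
  Cap (incl full (Comp (lif_of Zero) full))
    (Cap (incl full (Comp (atom Succ) full))
         (incl full (Comp (Conv (atom Head)) (atom Tail)))).

(* The pairs whose second component is a number [n] such that [f] relates
   [[:: n]] to 1. *)
Definition value1 (f : rexp) : rexp :=
  Seq (Seq Zero Succ) (Seq (Inv f) (Meet Head (Seq Tail (Inv Zero)))).

Definition not_value1 (f : rexp) : lif rexp_voc V :=
  Diff (Cap model_axioms (star_axioms f)) (lif_of (value1 f)).

(** Each successor adds one outermost composition, so the code is an iterate in [n], hence
    recursive. *)
Definition lif_numeral (n : nat) : lif rexp_voc V :=
  iter n (fun a => Comp a (atom Succ)) (lif_of Zero).

(** * Expressions that define relations on the domain *)

Section Semantics.
Variables (dom : Type) (D : interpretation rexp_voc dom).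

Definition defines (A : lif rexp_voc V) (R : dom -> dom -> Prop) :=
  forall nu1 nu2, sem D A (nu1, nu2) <->
    agree_outside (pred1 x) nu1 nu2 /\ R (nu1 x) (nu2 x).

Let I (a : rexp) (d d' : dom) : Prop := @D a [tuple d; d'].

Lemma agree_outside_trans Y (nu1 nu2 nu3 : valuation V dom) :
  agree_outside Y nu1 nu2 -> agree_outside Y nu2 nu3 ->
  agree_outside Y nu1 nu3.
Proof. by move=> e12 e23 v vY; rewrite e12 ?e23. Qed.

Lemma agree_outside_sym Y (nu1 nu2 : valuation V dom) :
  agree_outside Y nu1 nu2 -> agree_outside Y nu2 nu1.
Proof. by move=> e12 v vY; rewrite e12. Qed.

Lemma defines_atom a : defines (atom a) (I a).
Proof.
move=> nu1 nu2 /=; rewrite /mod_sem /=.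
have -> : tcast (subnKC (iar_le_ar (a : rexp_voc))) (cat_tuple
    (map_tuple nu1 [tuple x]) (map_tuple nu2 [tuple x]))
    = [tuple nu1 x; nu2 x] by apply: val_inj; rewrite /= val_tcast.
have ex v : (v \in mem [tuple x]) = (v \in pred1 x) by exact: mem_seq1.
by split=> [[Dx agr]|[agr Dx]]; split=> // v vx; apply: agr; rewrite ?ex // -ex.
Qed.

Lemma defines_id : defines Id eq.
Proof.
move=> nu1 nu2; split=> [e|[agr e]].
  by have <- : nu1 = nu2 := e.
apply: (_ : nu1 = nu2); apply/funext=> v.
by case: (eqVneq v x) => [->|/agr].
Qed.

Lemma defines_full : defines full (fun _ _ => True).
Proof.
have ex v : (v \in mem [fset x]%fset) = (v \in pred1 x) by exact: in_fset1.
move=> nu1 nu2; split=> [[nu e agr]|[agr _]].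
  have {}e : nu1 = nu := e; rewrite -{}e in agr.
  by split=> // v vx; apply: agr; rewrite ex.
by exists nu1 => // v vx; apply: agr; rewrite -ex.
Qed.

Lemma defines_conv A R : defines A R -> defines (Conv A) (fun d d' => R d' d).
Proof.
move=> AR nu1 nu2; split=> [/AR|] [agr RR].
  by split=> //; apply: agree_outside_sym.
by apply/AR; split=> //; apply: agree_outside_sym.
Qed.

Lemma defines_cap A B R Q : defines A R -> defines B Q ->
  defines (Cap A B) (fun d d' => R d d' /\ Q d d').
Proof.
move=> AR BQ nu1 nu2; split=> [[/AR [agr Rd] /BQ [_ Qd]] //|[agr [Rd Qd]]].
by split; [apply/AR | apply/BQ].
Qed.

Lemma defines_diff A B R Q : defines A R -> defines B Q ->
  defines (Diff A B) (fun d d' => R d d' /\ ~ Q d d').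
Proof.
move=> AR BQ nu1 nu2; split=> [[/AR [agr Rd] nB] | [agr [Rd nQ]]].
  by split=> //; split=> // Qd; apply: nB; apply/BQ.
by split=> [|/BQ []//]; apply/AR.
Qed.

Lemma defines_comp A B R Q : defines A R -> defines B Q ->
  defines (Comp A B) (fun d d' => exists2 c, R d c & Q c d').
Proof.
move=> AR BQ nu1 nu2.
split=> [[nu /AR [agr Rd] /BQ [agr' Qd]] | [agr [c Rd Qd]]].
  by split; [exact: agree_outside_trans agr agr' | exists (nu x)].
exists (fun v => if v == x then c else nu1 v); [apply/AR | apply/BQ].
  by split=> [v vx|]; [rewrite ifN | rewrite eqxx].
by split=> [v vx|]; [rewrite ifN // agr | rewrite eqxx].
Qed.

Lemma defines_ext A R Q : defines A R -> (forall d d', R d d' <-> Q d d') ->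
  defines A Q.
Proof. by move=> AR RQ nu1 nu2; rewrite AR; split=> -[agr /RQ]. Qed.

Lemma defines_lif_of a : defines (lif_of a) (eval I a).
Proof.
elim: a => /=.
- apply: defines_ext (defines_comp defines_full (defines_atom Zero)) _ => d d'.
  by split=> [[c _]|[c]]; exists c.
- exact: defines_atom.
- exact: defines_atom.
- exact: defines_atom.
- exact: defines_full.
- by move=> a /defines_conv.
- by move=> a /defines_cap H b /H.
- by move=> a /defines_comp H b /H.
- by move=> a _; apply: defines_atom.
Qed.

Lemma defines_incl A B R Q : defines A R -> defines B Q ->
  defines (incl A B) (fun _ _ => forall d d', R d d' -> Q d d').
Proof.
move=> AR BQ; have Dfull := defines_full.
apply: defines_ext (defines_diff Dfull (defines_comp Dfull
  (defines_comp (defines_diff AR BQ) Dfull))) _ => d d'.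
split=> [[_ nRQ] a b Rab|RQ].
  by apply: contrapT => nQ; apply: nRQ; exists a => //; exists b.
by split=> // -[a _ [b [/RQ Qab nQab]]].
Qed.

Lemma defines_star_axioms a :
  defines (star_axioms a) (fun _ _ => star_closed I a).
Proof.
elim: a => /=; try by do ?move=> ?; exact: defines_full.
- by [].
- by move=> a /defines_cap H b /H.
- by move=> a /defines_cap H b /H.
- move=> a IHa; have Da := defines_atom (Star a).
  apply: defines_ext (defines_cap IHa (defines_cap (defines_incl defines_id Da)
    (defines_incl (defines_comp Da (defines_lif_of a)) Da))) _ => d d'.
  split=> [[ca [refl step]]|[ca refl step]].
    by split=> // [y|y z w yz zw]; [apply: refl | apply: step; exists z].
  split=> //; split=> [y _ <- //|y w [z yz zw]]; exact: step yz zw.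
Qed.

Lemma defines_model_axioms : inhabited dom ->
  defines model_axioms (fun _ _ => arith_model I).
Proof.
move=> [d0]; have Dfull := defines_full; have Da := defines_atom.
apply: defines_ext (defines_cap
  (defines_incl Dfull (defines_comp (defines_lif_of Zero) Dfull))
  (defines_cap (defines_incl Dfull (defines_comp (Da Succ) Dfull))
  (defines_incl Dfull (defines_comp (defines_conv (Da Head)) (Da Tail))))) _.
move=> d d'; split=> [[mz [ms mp]]|[mz ms mp]].
  split=> [|y|y z]; last exact: mp.
    by have [y zy _] := mz d d' Logic.I; exists y.
  by have [z yz _] := ms y y Logic.I; exists z.
split=> [y z _|]; first by have [w wz] := mz; exists w.
split=> [y z _|y z _]; last exact: mp.
by have [w yw] := ms y; exists w.
Qed.

Lemma defines_not_value1 f : inhabited dom ->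
  defines (not_value1 f) (fun d d' =>
    [/\ arith_model I, star_closed I f & ~ eval I (value1 f) d d']).
Proof.
move=> d0; apply: defines_ext (defines_diff (defines_cap
  (defines_model_axioms d0) (defines_star_axioms f))
  (defines_lif_of (value1 f))) _ => d d'.
by split=> [[[]]|[]].
Qed.

Lemma defines_lif_numeral n : defines (lif_numeral n) (fun _ => numeral I n).
Proof.
elim: n => [|n IHn]; first exact: (defines_lif_of Zero).
exact: defines_comp IHn (defines_atom Succ).
Qed.

End Semantics.

(** For [y = 1] soundness rules out every model; for [y = 0] the standard model is a witness. *)
Lemma sem_outputs_value1 (dom : Type) (e : dom -> nat) (e' : nat -> dom)
    (f : recfun 1) (n y : nat) :
  cancel e' e -> rec_graph f [tuple n] y -> y < 2 ->
  sem_outputs dom (Cap (not_value1 (compile f)) (lif_numeral n)) x <-> y = 0.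
Proof.
move=> e'K fn lty; have d0 : inhabited dom by exists; exact: e' 0.
have defE D := defines_cap (defines_not_value1 D (compile f) d0)
                           (defines_lif_numeral D n).
split=> [[D [nu1 [nu2 [/defE [_ [[IP sc nval] num] _]]]]] | y0].
  case: y lty fn => [|[|//]] // _ fn; case: nval.
  (* A list with head [nu2 x] and a zero as tail represents [[:: n]]; as the value is 1, [value1]
     relates every element to [nu2 x]. *)
  have [z z0] := numeral_ex IP 0; have [t tx tz] := model_pair IP (nu2 x) z.
  have [|u u1 fu] := compile_sound IP sc fn (t := t).
    by exists (nu2 x), z.
  exists u; first by case: u1 => w w0 wu; exists w.
  by exists t => //; split=> //; exists z.
pose D : interpretation rexp_voc dom :=
  fun a => [set t : 2.-tuple dom |
    std e a (tnth t ord0) (tnth t ord_max)]%classic.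
have DE : (fun a d d' => D a [tuple d; d']) = std e.
  by do 3!apply/funext=> ?; rewrite /D /= !(tnth_nth (e' 0)).
have e_surj m : exists d, e d = m by exists (e' m).
(* [value1] ignores its first component, so [n.+1] is merely a number different from [n]. *)
exists D, (fun v => e' (if v == x then n.+1 else n)), (fun=> e' n).
split; last first.
  by move/(congr1 e); rewrite !e'K eqxx => /eqP; rewrite gtn_eqF.
apply/defE; split=> [v vx|]; last split.
- by rewrite ifN.
- rewrite DE; split; [exact: std_model | exact: std_star_closed |].
  move/eval_std => /= [u [z z0 uz] [t ft [[l tl] [r [m tm] r0]]]].
  have fu : rec_graph f [tuple n] (e u).
    apply: std_compile ft; rewrite tm; move: tl; rewrite tm e'K r0.
    by case=> -> _.
  by have := rec_graph_functional fn fu; rewrite y0 uz z0.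
- by rewrite DE; apply: std_numeral => //; rewrite e'K.
Qed.
End Translation.

(** * Diagonalisation *)

Theorem proposition3p16 (V : countType) (dom : Type)
    (V_inhabited : inhabited V)
    (dom_denumerable : exists f : nat -> dom, bijective f) :
  ~ algorithmically_decidable (@osem_code V) (@osem_membership V dom).
Proof.
case: V_inhabited dom_denumerable => x [e' [e e'K _]] [f fP].
pose cS := lif_code (atom x Succ).
pose num n := lif_code (lif_numeral x n).
have numE n : num n = iter n (fun c => CodeSeq.code [:: 5; c; cS]) (num 0).
  by rewrite /num; elim: n => //= n ->.
have rnum : recursive1 num.
  have rstep : recursive2 (fun _ c => CodeSeq.code [:: 5; c; cS]).
    apply: (@recursive_code _ [:: fun=> 5; fun v => tnth v ord_max; fun=> cS]).
    split; first exact: recursive_const.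
    by split; [apply: recursive_proj | split=> //; apply: recursive_const].
  have r1 : recursive1 id by apply: recursive_proj.
  have := recursive_iter (b := fun=> num 0) rstep (recursive_const _ _).
  move=> /recursive_comp2 /(_ r1 r1); apply: eq_recursive => v.
  by rewrite numE.
(* The code of the instance formed by the expression coded by [t] and the
   numeral [t]. *)
pose self t :=
  CodeSeq.code [:: pickle x; CodeSeq.code [:: 3; t; num t]].
have [s sP] : recursive1 self.
  apply: (@recursive_code _ [:: fun=> pickle x; fun v =>
    CodeSeq.code [:: 3; tnth v ord0; num (tnth v ord0)]]).
  split; first exact: recursive_const.
  split=> //.
  apply: (@recursive_code _ [:: fun=> 3; fun v => tnth v ord0;
    fun v => num (tnth v ord0)]).
  split; first exact: recursive_const.
  by split; [apply: recursive_proj | split].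
pose g := RComp f (fun=> s).
pose A := not_value1 x (compile g).
pose m := lif_code A.
pose i := OsemInstance x (Cap A (lif_numeral x m)).
(* The code of [i] is [self m] by computation. *)
have gP y : rec_graph f [tuple osem_code i] y -> rec_graph g [tuple m] y.
  move=> fy; exists [tuple osem_code i] => // j.
  rewrite (tnth_nth 0) ord1; exact: (sP [tuple m]).
have iP y : rec_graph g [tuple m] y -> y < 2 -> osem_membership dom i <-> y = 0.
  exact: sem_outputs_value1.
have [yes no] := fP i.
(* If [i] is positive, [f] answers 1 and so does [g] at [m], against [iP]; otherwise both answer 0,
   and [iP] makes [i] positive. *)
have [P|nP] := pselect (osem_membership dom i).
  by have [/(_ P)] := iP _ (gP _ (yes P)) isT.
by apply: (nP); apply/(iP _ (gP _ (no nP))).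
Qed.
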